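(* Let $\lambda$ be an infinite cardinal, and let $(Y_\alpha)_{\alpha\in\lambda}$ be a sequence of subsets of a topological space $X$. Then $x\in X$ is a $\lambda$-complete accumulation point of $(Y_\alpha)_{\alpha\in\lambda}$ if and only if there exists an ultrafilter $D$ uniform over $\lambda$ such that $x$ is a $D$-limit point of $(Y_\alpha)_{\alpha\in\lambda}$. In particular, $(Y_\alpha)_{\alpha\in\lambda}$ has a $\lambda$-complete accumulation point if and only if $(Y_\alpha)_{\alpha\in\lambda}$ has a $D$-limit point for some ultrafilter $D$ uniform over $\lambda$.
   Context: No separation axioms are assumed. An ultrafilter $D$ over an infinite cardinal $\lambda$ is uniform if every member of $D$ has cardinality $\lambda$. A point $x\in X$ is a $\lambda$-complete accumulation point of $(Y_\alpha)_{\alpha\in\lambda}$ if $|\{\alpha\in\lambda\mid Y_\alpha\cap U\neq\emptyset\}|=\lambda$ for every neighborhood $U$ of $x$ in $X$. If $D$ is an ultrafilter over $\lambda$, $x$ is a $D$-limit point of $(Y_\alpha)_{\alpha\in\lambda}$ if $\{\alpha\in\lambda\mid Y_\alpha\cap U\ne\emptyset\}\in D$ for every neighborhood $U$ of $x$ in $X$. *)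

(* Defs.v *)
From HB Require Import structures.
From mathcomp Require Import all_boot all_order.
From mathcomp Require Import boolp classical_sets functions cardinality filter.
From mathcomp Require Import topology.

Set Implicit Arguments.
Unset Strict Implicit.
Unset Printing Implicit Defensive.

Local Open Scope classical_set_scope.
Local Open Scope card_scope.

(* A cardinal is represented by an arbitrary type [L] of that cardinality;    *)
(* "|A| = lambda" for A a subset of lambda reads [A #= [set: L]]. The order   *)
(* structure of the cardinal is not used by any of these notions.             *)

Definition uniform_ultrafilter (L : Type) (D : set_system L) : Prop :=
  UltraFilter D /\ forall A : set L, D A -> A #= [set: L].

Definition complete_accumulation_point (L : Type) (X : topologicalType)
    (Y : L -> set X) (x : X) : Prop :=
  forall U : set X, nbhs x U ->
    [set a : L | Y a `&` U !=set0] #= [set: L].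

Definition ultrafilter_limit_point (L : Type) (X : topologicalType)
    (D : set_system L) (Y : L -> set X) (x : X) : Prop :=
  forall U : set X, nbhs x U -> D [set a : L | Y a `&` U !=set0].

(* Main.v *)
Require Import Defs.
From mathcomp Require Import all_boot all_order.
From mathcomp Require Import boolp classical_sets functions cardinality filter.
From mathcomp Require Import topology.

Local Open Scope classical_set_scope.

(** The sets of cardinality less than an infinite [lambda] form an ideal,
    because [2 * kappa = kappa] for infinite [kappa].  If [x] is a complete
    accumulation point, the sets that contain some [{a | Y a meets U}], [U] a
    neighborhood of [x], up to a small set form a proper filter, which contains
    all complements of small sets.  Any ultrafilter extending it is uniform and
    has [x] as a limit point. *)

Local Open Scope card_scope.

(** The injections below are described by cases. Giving each as a relation confines the choice of a
    function to this proof. *)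
Lemma card_le_rel {T U : Type} {A : set T} {B : set U} (R : T -> U -> Prop) :
  (forall x, A x -> exists2 y, B y & R x y) ->
  (forall x x' y, A x -> A x' -> R x y -> R x' y -> x = x') ->
  A #<= B.
Proof.
elim/Ppointed: U => U in B R *.
  move=> AR _; suff -> : A = set0 by exact: card_ge0.
  by rewrite -subset0 => x /AR[y]; case: (no y).
move=> AR Rinj.
have /choice[f fP] x : exists y, A x -> B y /\ R x y.
  have [/AR[y By Rxy]|nAx] := pselect (A x); first by exists y.
  by exists point.
apply/pcard_leP/injfunPex; exists f; first by move=> x /fP[].
move=> x x' /set_mem Ax /set_mem Ax' fE; apply: (Rinj _ _ (f x)) => //.
  by have [] := fP _ Ax.
by rewrite fE; have [] := fP _ Ax'.
Qed.

Lemma card_le_injP {T : Type} {U : pointedType} {A : set T} {B : set U} :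
  A #<= B -> exists2 f : T -> U, (forall x, A x -> B (f x)) &
    forall x y, A x -> A y -> f x = f y -> x = y.
Proof.
move=> /pcard_leP/injfunPex[f fAB finj]; exists f => // x y Ax Ay.
by apply: finj; exact: mem_set.
Qed.

(** Zorn's lemma gives a maximal graph of a partial injection from [A] to [B]. It is defined on all
    of [A] or hits all of [B], for otherwise a pair of missed points could be added. *)
Lemma card_le_total {T U : Type} (A : set T) (B : set U) :
  A #<= B \/ B #<= A.
Proof.
pose P (G : set (T * U)) := G `<=` A `*` B /\
  forall p q, G p -> G q -> (p.1 = q.1 <-> p.2 = q.2).
have [|G [[GAB PG] Gmax]] := @Zorn_bigcup _ P.
  move=> F FP Ftot; split; first by move=> p [G /FP[GAB _] /GAB].
  move=> p q [G FG Gp] [H FH Hq].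
  have [GH|HG] := Ftot _ _ FG FH.
    exact: ((FP _ FH).2 p q (GH _ Gp) Hq).
  exact: ((FP _ FG).2 p q Gp (HG _ Hq)).
have [AG|] := pselect (forall a, A a -> exists2 b, B b & G (a, b)).
  left; apply: (card_le_rel (fun a b => G (a, b))) => // a a' b _ _ ab ab'.
  exact/(PG _ _ ab ab').
move=> /existsNP[a /not_implyP[Aa aG]].
have [BG|] := pselect (forall b, B b -> exists2 a, A a & G (a, b)).
  right; apply: (card_le_rel (fun b a => G (a, b))) => // b b' c _ _ ab ab'.
  exact/(PG _ _ ab ab').
move=> /existsNP[b /not_implyP[Bb bG]]; exfalso.
have aN y : ~ G (a, y).
  by move=> ay; apply: aG; exists y => //; have [] := GAB _ ay.
have bN x : ~ G (x, b).
  by move=> xb; apply: bG; exists x => //; have [] := GAB _ xb.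
apply: (Gmax (G `|` [set (a, b)])).
  rewrite properEneq; split; last by left.
  by apply/eqP => e; apply: (aN b); rewrite e; right.
split; first by move=> p [/GAB//|->].
move=> [x y] [x' y'] [Gp|[-> ->]] [Gq|[-> ->]] //=; first exact: (PG _ _ Gp Gq).
- by split=> e; move: Gp; rewrite e => ?; [case: (aN y)|case: (bN x)].
- by split=> e; move: Gq; rewrite -e => ?; [case: (aN y')|case: (bN x')].
Qed.

(** A maximal family of disjoint injective sequences in [B] covers [B] up to a finite set. Each
    sequence splits into its even and odd terms, which doubles the covered part [D]. *)
Lemma card_le_double {T : Type} (B : set T) :
  infinite_set B -> B `*` [set: bool] #<= B.
Proof.
elim/Ppointed: T => T in B *.
  by rewrite emptyE => /(_ (finite_set0 _)).
move=> Binf.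
(* The second clause makes each sequence injective and distinct sequences disjoint. *)
pose P (F : set (nat -> T)) := (forall f n, F f -> B (f n)) /\
  forall f g m n, F f -> F g -> f m = g n -> f = g /\ m = n.
have [|F [[FB Fdisj] Fmax]] := @Zorn_bigcup _ P.
  move=> C CP Ctot; split; first by move=> f n [F /CP[FB _] /FB].
  move=> f g m n [F CF Ff] [G CG Gg].
  have [FG|GF] := Ctot _ _ CF CG.
    exact: ((CP _ CG).2 f g m n (FG _ Ff) Gg).
  exact: ((CP _ CF).2 f g m n Ff (GF _ Gg)).
pose D := [set x | exists f n, F f /\ x = f n].
have DB : D `<=` B by move=> x [f [n [Ff ->]]]; exact: FB.
have BDfin : finite_set (B `\` D).
  (* An infinite remainder would contain an injective sequence [h], which could be added to [F]. *)
  apply: contrapT => /infiniteP/card_le_injP[h hBD hinj].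
  have hN f m n : F f -> h m <> f n.
    by move=> Ff e; have [_] := hBD m I; apply; exists f, n.
  apply: (Fmax (F `|` [set h])).
    rewrite properEneq; split; last by left.
    by apply/eqP => e; apply: (hN h 0 0) => //; rewrite e; right.
  split; first by move=> f n [/FB//|->]; have [] := hBD n I.
  move=> f g m n [Ff|->] [Fg|->] e; first exact: Fdisj.
  - by case: (hN f n m).
  - by case: (hN g m n).
  - by split=> //; exact: hinj.
have Dinf : infinite_set D.
  move=> Dfin; apply: Binf; rewrite -(setDUK DB).
  by rewrite finite_setU.
have /card_le_injP[e _ einj] := finite_set_countable BDfin.
have /infiniteP/card_le_injP[h hD hinj] := Dinf.
have /card_le_injP[j jD jinj] : B #<= D.
  (* A Hilbert hotel makes room for the finite set [B `\` D] inside [D]. *)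
  pose R x y := [\/ (~ D x) /\ y = h (e x).*2,
    exists n, x = h n /\ y = h n.*2.+1 |
    [/\ D x, (forall n, x <> h n) & y = x]].
  apply: (card_le_rel R) => [x Bx|x x' y Bx Bx'].
    have [Dx|nDx] := pselect (D x); last first.
      by exists (h (e x).*2); [exact: hD | constructor 1].
    have [[n xh]|nh] := pselect (exists n, x = h n).
      by exists (h n.*2.+1); [exact: hD | constructor 2; exists n].
    exists x => //; constructor 3; split=> // n xh.
    by apply: nh; exists n.
  move=> [[nDx yE]|[n [xE yE]]|[Dx nh yE]]
    [[nDx' yE']|[n' [xE' yE']]|[Dx' nh' yE']].
  (* Mixed cases fail by the parity of the index of [h], or because the third clause of [R] stays
     off the range of [h]. *)
  - apply: einj => //; apply: double_inj.
    by apply: hinj => //; rewrite -yE -yE'.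
  - have /(hinj _ _ I I)/(congr1 odd) : h (e x).*2 = h n'.*2.+1 by rewrite -yE.
    by rewrite /= !odd_double.
  - by case: (nh' (e x).*2); rewrite -yE' -yE.
  - have /(hinj _ _ I I)/(congr1 odd) : h (e x').*2 = h n.*2.+1 by rewrite -yE'.
    by rewrite /= !odd_double.
  - have /(hinj _ _ I I)[/double_inj nn] : h n.*2.+1 = h n'.*2.+1
      by rewrite -yE.
    by rewrite xE xE' nn.
  - by case: (nh' n.*2.+1); rewrite -yE' -yE.
  - by case: (nh (e x').*2); rewrite -yE -yE'.
  - by case: (nh n'.*2.+1); rewrite -yE -yE'.
  - by rewrite -yE -yE'.
(* If [j x] is term [n] of a sequence, [(x, false)] goes to its term [2n] and [(x, true)] to its
   term [2n+1]; parity recovers the tag. *)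
pose R (p : T * bool) y :=
  exists f n, [/\ F f, j p.1 = f n & y = f (p.2 + n.*2)%N].
apply: (card_le_rel R) => [[x b] [/= /jD[f [n [Ff jx]]] _]|].
  by exists (f (b + n.*2)%N); [exact: FB | exists f, n].
move=> [x b] [x' b'] y [/= Bx _] [/= Bx' _].
move=> [f [n [Ff jx yE]]] [f' [n' [Ff' jx' yE']]]; rewrite /= in jx jx' yE yE'.
have [ff nn] : f = f' /\ (b + n.*2 = b' + n'.*2)%N.
  by apply: Fdisj => //; rewrite -yE.
have bb : b = b'.
  by move: (congr1 odd nn); rewrite !oddD !odd_double !addbF !oddb.
have {}nn : n = n' by move: nn; rewrite bb => /addnI/double_inj.
by congr pair => //; apply: jinj => //; rewrite jx jx' ff nn.
Qed.

(** The union embeds in two copies of [B]: points of [B] go to one, the others to the second along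
    the injection of [A]. *)
Lemma card_le_setU {T : Type} {A B : set T} :
  infinite_set B -> A #<= B -> A `|` B #<= B.
Proof.
elim/Ppointed: T => T in A B *.
  by rewrite [B]emptyE => /(_ (finite_set0 _)).
move=> Binf /card_le_injP[f fB finj].
apply: card_le_trans (card_le_double _ Binf).
pose R x (p : T * bool) := if p.2 then p.1 = x else (~ B x) /\ p.1 = f x.
apply: (card_le_rel R) => [x ABx|x x' [y [|]] ABx ABx']; rewrite /R /=.
- have [Bx|nBx] := pselect (B x); first by exists (x, true).
  by exists (f x, false) => //; split => //=; apply: fB; case: ABx.
- by move=> <-.
- move=> [nBx yE] [nBx' yE']; apply: finj; last by rewrite -yE.
    by case: ABx.
  by case: ABx'.
Qed.

(** The larger of [A] and [B] is infinite, as their union is, so it absorbs the other. This is the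
    ideal property of small sets, in contrapositive form. *)
Lemma card_ge_setU {T U : Type} {C : set U} {A B : set T} :
  infinite_set C -> C #<= A `|` B -> C #<= A \/ C #<= B.
Proof.
wlog AB : A B / A #<= B.
  move=> wl Cinf CAB; have [AB|BA] := card_le_total A B; first exact: wl.
  by apply/or_comm; apply: wl => //; rewrite setUC.
move=> Cinf CAB; right; apply: (card_le_trans CAB (card_le_setU _ AB)) => Bfin.
apply: Cinf; apply: card_le_finite CAB _.
by rewrite finite_setU; split => //; exact: card_le_finite AB Bfin.
Qed.

Lemma uniform_ultrafilter_limit_point {L : Type} {X : topologicalType}
    (Y : L -> set X) (x : X) :
  infinite_set [set: L] -> complete_accumulation_point Y x ->
  exists D : set_system L,
    uniform_ultrafilter D /\ ultrafilter_limit_point D Y x.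
Proof.
move=> Linf xY; pose M U := [set a | Y a `&` U !=set0].
pose F : set_system L :=
  [set A | exists2 U, nbhs x U & ~ ([set: L] #<= M U `\` A)].
have small0 : ~ ([set: L] #<= @set0 L).
  by move=> L0; apply: Linf; exact: card_le_finite L0 (finite_set0 _).
have FP : ProperFilter F.
  (* Properness is where accumulation enters: [M U] itself is never small. *)
  split; first by move=> [U /xY /card_eqPle[_ LU]]; apply; rewrite setD0.
  split.
  - by exists setT; [exact: filterT | rewrite setDT].
  - move=> A B [U xU AU] [V xV BV]; exists (U `&` V); first exact: filterI.
    have sub : M (U `&` V) `\` (A `&` B) `<=` (M U `\` A) `|` (M V `\` B).
      move=> a [[y [Yy [Uy Vy]]] /not_andP[nA|nB]].
        by left; split=> //; exists y.
      by right; split=> //; exists y.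
    move=> /card_le_trans/(_ (subset_card_le sub)).
    by move=> /(card_ge_setU Linf)[].
  - move=> A B AB [U xU AU]; exists U => // BU; apply: AU.
    apply: card_le_trans BU _; apply: subset_card_le => a [Ma nB].
    by split=> // /AB.
have [D [DU FD]] := ultraFilterLemma FP.
exists D; split; last first.
  by move=> U xU; apply: FD; exists U => //; rewrite setDv.
split=> // A DA; apply/card_eqPle; split; first exact: card_leT.
(* If [A] were small, its complement would lie in [F], with the whole space as neighborhood, and
   hence in [D] together with [A]. *)
apply: contrapT => LA; apply: (@filter_not_empty _ D _).
rewrite -(setICr A); apply: filterI => //; apply: FD; exists setT.
  exact: filterT.
move=> /card_le_trans LM; apply: LA; apply: LM.
by apply: subset_card_le => a [_ /contrapT].
Qed.

Theorem proposition4p1 (lambda : Type) (lambda_infinite : infinite_set [set: lambda])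
    (X : topologicalType) (Y : lambda -> set X) :
  (forall x : X,
     complete_accumulation_point Y x <->
     exists D : set_system lambda,
       uniform_ultrafilter D /\ ultrafilter_limit_point D Y x) /\
  ((exists x : X, complete_accumulation_point Y x) <->
   exists D : set_system lambda,
     uniform_ultrafilter D /\ exists x : X, ultrafilter_limit_point D Y x).
Proof.
have limit_iff (x : X) : complete_accumulation_point Y x <->
    exists D, uniform_ultrafilter D /\ ultrafilter_limit_point D Y x.
  split; first exact: uniform_ultrafilter_limit_point.
  by move=> [D [[_ Dcard] Dx]] U /Dx/Dcard.
split=> //; split=> [[x /limit_iff[D [DU Dx]]]|[D [DU [x Dx]]]].
  by exists D; split=> //; exists x.
by exists x; apply/limit_iff; exists D.
Qed.
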